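(* Let $\varphi$ be an endomorphism of a subshift $(X,\sigma)$. Let $s\in\mathbb Z$. (1) $\varphi\sigma^s$ has memory zero if and only if $s\ge -P_L(\varphi)$; $\varphi\sigma^s$ has anticipation zero if and only if $s\le P_R(\varphi)$. (2) Suppose that $\varphi$ is onto. Then $\varphi\sigma^s$ is weakly $p$-L if and only if $s\ge -P_L(\varphi)$, and if $s>-P_L(\varphi)$ then $\varphi\sigma^s$ is right $\sigma$-expansive on the upper side. Likewise $\varphi\sigma^s$ is weakly $p$-R if and only if $s\le P_R(\varphi)$, and if $s<P_R(\varphi)$ then $\varphi\sigma^s$ is left $\sigma$-expansive on the upper side. (3) If $(X,\sigma)$ is a topological Markov shift, then the statements in (2) with every ''weakly'' deleted hold.
   Context: **Subshifts.** An alphabet is a finite set with at least two elements. For an alphabet $A$, $A^{\mathbb Z}$ carries the product topology; the shift maps $(a_j)_j$ to $(a_{j+1})_j$. A subshift $(X,\sigma)$ over $A$ is a closed $X\subset A^{\mathbb Z}$ with $\sigma(X)=X$, $\sigma$ being the restricted shift; $d_X$ is a compatible metric; $L_k(X)$ is the set of words of length $k$ occurring in points of $X$. An endomorphism of $(X,\sigma)$ is a continuous map $\varphi:X\to X$ commuting with $\sigma$ (not assumed onto). **Type.** A local rule of neighborhood-size $N\ge 0$ on $X$ is a map $f:L_{N+1}(X)\to L_1(X)$ with $(f(a_j\dots a_{j+N}))_{j\in\mathbb Z}\in X$ for all $(a_j)\in X$. For $m,n\ge0$, $m+n=N$, $\varphi$ is of $(m,n)$-type given by $f$ if $\varphi((a_j)_j)=(f(a_{j-m}\dots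 a_{j+n}))_j$. Every endomorphism arises this way. $\varphi$ has memory zero (resp. anticipation zero) if it is of $(0,n)$-type for some $n\ge0$ (resp. of $(m,0)$-type for some $m\ge0$). **$p$-degrees.** A local rule $f$ of neighborhood-size $N$ is $I$ left-redundant ($I\ge0$) if for all $(a_j),(b_j)\in X$, $a_j=b_j$ for all $j\ge0$ implies $f(a_{-I}\dots a_{-I+N})=f(b_{-I}\dots b_{-I+N})$; $I$ right-redundant if $a_j=b_j$ for all $j\le0$ implies $f(a_{I-N}\dots a_I)=f(b_{I-N}\dots b_I)$. It is strictly $I$ left-redundant if $I$ left-redundant but not $I+1$ left-redundant, strictly $\infty$ left-redundant if $I$ left-redundant for all $I\ge0$; similarly for right. If $\varphi$ is of $(m,n)$-type given by $f$ which is strictly $I$ left-redundant and strictly $J$ right-redundant, then $P_L(\varphi)=I-m$ and $P_R(\varphi)=J-n$ (in $\mathbb Z\cup\{\infty\}$); these are independent of the choice of $f,m,n$. **Graphs.** A graph is a finite directed graph $G$ (multiple arcs, loops allowed) with arc-set $A_G$, vertex-set $V_G$ and initial/terminal vertex maps $i_G,t_G$; it is nondegenerate if $i_G,t_G$ are onto. $X_G\subset A_G^{\mathbb Z}$ is the set of bi-infinite paths and $\sigma_G$ its shift; for $G$ nondegenerate, $(X_G,\sigma_G)$ is called a topological Markov shift. A graph-homomorphism $h=(h_A,h_V):\Gamma\to G$ is a pair of maps on arcs and vertices compatible with $i,t$; it induces $\phi_h:X_\Gamma\to X_G$, $(\alpha_j)\mapsto(h_A(\alpha_j))$. $h$ is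 weakly left-resolving (resp. weakly right-resolving) if every arc $\alpha$ of $\Gamma$ is uniquely determined by $t_\Gamma(\alpha)$ (resp. $i_\Gamma(\alpha)$) and $h_A(\alpha)$; it is left-resolving (resp. right-resolving) if for every $u\in V_\Gamma$, $a\in A_G$ with $t_G(a)=h_V(u)$ (resp. $i_G(a)=h_V(u)$) there is a unique $\alpha\in A_\Gamma$ with $h_A(\alpha)=a$ and $t_\Gamma(\alpha)=u$ (resp. $i_\Gamma(\alpha)=u$). **Resolving endomorphisms.** A textile system $T=(p,q:\Gamma\to G)$ is a pair of graph-homomorphisms $p,q:\Gamma\to G$. $T$ is (weakly) $p$-L if $p$ is (weakly) left-resolving, (weakly) $p$-R if $p$ is (weakly) right-resolving. For each of these terms $\mathcal P$: an endomorphism $\varphi$ of $(X,\sigma)$ is weakly $\mathcal P$ if there are a weakly $\mathcal P$ textile system $T=(p,q:\Gamma\to G)$ and a closed shift-invariant $Z\subset X_\Gamma$ such that $\phi_p|_Z$ is injective, $\phi_p(Z)=X$, $\phi_q(Z)\subset X$ and $\varphi=\phi_q\circ(\phi_p|_Z)^{-1}$. An onto endomorphism $\varphi$ of a topological Markov shift $(X_G,\sigma_G)$ is $\mathcal P$ if there is a $\mathcal P$ textile system $T=(p,q:\Gamma\to G)$ such that, with $Z_T$ the set of $z\in X_\Gamma$ for which there is $(z_i)_{i\in\mathbb Z}$ in $X_\Gamma$ with $z_0=z$ and $\phi_q(z_{i-1})=\phi_p(z_i)$ for all $i$, one has $\phi_p(Z_T)=X_G$, $\phi_p|_{Z_T}$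 is injective and $\varphi=\phi_q\circ(\phi_p|_{Z_T})^{-1}$. **Expansiveness.** An onto endomorphism $\varphi$ is left (resp. right) $\sigma$-expansive on the upper side if there is $\delta>0$ such that for any sequences $(x_i)_{i\in\mathbb Z},(y_i)_{i\in\mathbb Z}$ in $X$ with $\varphi(x_i)=x_{i+1}$, $\varphi(y_i)=y_{i+1}$, $d_X(\sigma^j(x_i),\sigma^j(y_i))\le\delta$ for all $i\le0$ and all $j\le0$ (resp. $j\ge0$) implies $(x_i)_{i\in\mathbb Z}=(y_i)_{i\in\mathbb Z}$. *)

(* Defs.v *)
From HB Require Import structures.
From mathcomp Require Import all_boot all_order all_algebra.
From mathcomp Require Import all_classical all_reals all_analysis.

Set Implicit Arguments.
Unset Strict Implicit.
Unset Printing Implicit Defensive.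

Import Order.TTheory GRing.Theory Num.Theory.

Local Open Scope classical_set_scope.
Local Open Scope ring_scope.

Definition fullshift (A : finType) : Type := {ptws int -> discrete_topology A}.

HB.instance Definition _ (A : finType) :=
  Topological.copy (fullshift A) {ptws int -> discrete_topology A}.

(* [shiftz s] is the s-th power of the shift map; the shift map is [shiftz 1]. *)
Definition shiftz (A : finType) (s : int) (x : fullshift A) : fullshift A :=
  fun j : int => x (j + s).

Definition subshift (A : finType) (X : set (fullshift A)) : Prop :=
  closed X /\ shiftz 1 @` X = X.

(* [d] is only required to be a metric on [X]; the last clause says that its
   balls generate the neighborhoods of the subspace topology of [X]. *)
Definition compatible_metric (R : realType) (A : finType)
    (X : set (fullshift A)) (d : fullshift A -> fullshift A -> R) : Prop :=
  [/\ forall x y, X x -> X y -> 0 <= d x y,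
      forall x y, X x -> X y -> d x y = 0 <-> x = y,
      forall x y, X x -> X y -> d x y = d y x,
      forall x y z, X x -> X y -> X z -> d x z <= d x y + d y z &
      forall x, X x -> forall U : set (fullshift A),
        within X (nbhs x) U <->
        exists2 e : R, 0 < e & forall y, X y -> d x y < e -> U y].

(* An endomorphism of [X] is represented by a map on the whole full shift of
   which only the values on [X] are used. *)
Definition endomorphism (A : finType) (X : set (fullshift A))
    (phi : fullshift A -> fullshift A) : Prop :=
  [/\ forall x, X x -> X (phi x),
      {within X, continuous phi} &
      forall x, X x -> phi (shiftz 1 x) = shiftz 1 (phi x)].

Definition onto (A : finType) (X : set (fullshift A))
    (phi : fullshift A -> fullshift A) : Prop :=
  phi @` X = X.

(* The word x_i x_(i+1) ... x_(i+k-1). *)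
Definition word (A : finType) (x : fullshift A) (i : int) (k : nat) :
    k.-tuple A :=
  [tuple (x (i + (l : nat)%:Z) : A) | l < k].

(* A local rule of neighborhood-size N is represented by a map on all words of
   length N+1, of which only the values on the words occurring in [X] are used;
   its values on these words automatically occur in [X]. *)
Definition local_rule (A : finType) (X : set (fullshift A)) (N : nat)
    (f : N.+1.-tuple A -> A) : Prop :=
  forall x, X x -> X (fun j : int => f (word x j N.+1)).

Definition of_type (A : finType) (X : set (fullshift A))
    (phi : fullshift A -> fullshift A) (m n : nat)
    (f : (m + n).+1.-tuple A -> A) : Prop :=
  local_rule X f /\
  forall x, X x -> forall j : int,
    phi x j = f (word x (j - m%:Z) (m + n).+1).

Definition memory_zero (A : finType) (X : set (fullshift A))
    (phi : fullshift A -> fullshift A) : Prop :=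
  exists n (f : (0 + n).+1.-tuple A -> A), of_type X phi f.

Definition anticipation_zero (A : finType) (X : set (fullshift A))
    (phi : fullshift A -> fullshift A) : Prop :=
  exists m (f : (m + 0).+1.-tuple A -> A), of_type X phi f.

Definition left_redundant (A : finType) (X : set (fullshift A)) (N : nat)
    (f : N.+1.-tuple A -> A) (I : nat) : Prop :=
  forall a b, X a -> X b -> (forall j : int, 0 <= j -> a j = b j) ->
    f (word a (- I%:Z) N.+1) = f (word b (- I%:Z) N.+1).

Definition right_redundant (A : finType) (X : set (fullshift A)) (N : nat)
    (f : N.+1.-tuple A -> A) (I : nat) : Prop :=
  forall a b, X a -> X b -> (forall j : int, j <= 0 -> a j = b j) ->
    f (word a (I%:Z - N%:Z) N.+1) = f (word b (I%:Z - N%:Z) N.+1).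

Definition strictly (redundant : nat -> Prop) (I : \bar int) : Prop :=
  match I with
  | EFin i => exists k : nat, [/\ i = k%:Z, redundant k & ~ redundant k.+1]
  | +oo%E => forall k, redundant k
  | -oo%E => False
  end.

(* For an endomorphism of a subshift, a type (m, n) and a local rule f exist and
   the degree does not depend on their choice, so that each of the two sets
   below is a singleton and the default value of [xget] is irrelevant. *)
Definition PL (A : finType) (X : set (fullshift A))
    (phi : fullshift A -> fullshift A) : \bar int :=
  xget +oo%E [set p | exists m n (f : (m + n).+1.-tuple A -> A) (I : \bar int),
    [/\ of_type X phi f, strictly (left_redundant X f) I &
        p = (I - m%:Z%:E)%E]].

Definition PR (A : finType) (X : set (fullshift A))
    (phi : fullshift A -> fullshift A) : \bar int :=
  xget +oo%E [set p | exists m n (f : (m + n).+1.-tuple A -> A) (J : \bar int),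
    [/\ of_type X phi f, strictly (right_redundant X f) J &
        p = (J - n%:Z%:E)%E]].

(* A finite directed graph with arc-set A. *)
Record digraph (A : finType) := Digraph {
  vert : finType;
  ini : A -> vert;
  ter : A -> vert
}.

Definition nondegenerate_graph (A : finType) (G : digraph A) : Prop :=
  (forall v, exists a, ini G a = v) /\ (forall v, exists a, ter G a = v).

Definition path_space (A : finType) (G : digraph A) : set (fullshift A) :=
  [set x | forall j : int, ter G (x j) = ini G (x (j + 1))].

Record graph_hom (B A : finType) (Gamma : digraph B) (G : digraph A) :=
  GraphHom {
    hom_arc :> B -> A;
    hom_vert : vert Gamma -> vert G;
    hom_ini : forall b, ini G (hom_arc b) = hom_vert (ini Gamma b);
    hom_ter : forall b, ter G (hom_arc b) = hom_vert (ter Gamma b)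
  }.

Definition path_map (B A : finType) (Gamma : digraph B) (G : digraph A)
    (h : graph_hom Gamma G) (z : fullshift B) : fullshift A :=
  fun j : int => h (z j).

Definition hom_property : Type :=
  forall (B A : finType) (Gamma : digraph B) (G : digraph A),
    graph_hom Gamma G -> Prop.

Definition weakly_left_resolving : hom_property :=
  fun B A Gamma G h => forall b b' : B,
    ter Gamma b = ter Gamma b' -> h b = h b' -> b = b'.

Definition weakly_right_resolving : hom_property :=
  fun B A Gamma G h => forall b b' : B,
    ini Gamma b = ini Gamma b' -> h b = h b' -> b = b'.

Definition left_resolving : hom_property :=
  fun B A Gamma G h => forall (u : vert Gamma) (a : A),
    ter G a = hom_vert h u -> exists! b : B, h b = a /\ ter Gamma b = u.

Definition right_resolving : hom_property :=
  fun B A Gamma G h => forall (u : vert Gamma) (a : A),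
    ini G a = hom_vert h u -> exists! b : B, h b = a /\ ini Gamma b = u.

Record textile (B A : finType) (Gamma : digraph B) (G : digraph A) := Textile {
  tp : graph_hom Gamma G;
  tq : graph_hom Gamma G
}.

(* The last clause says phi = phi_q o (phi_p|Z)^-1 on X = phi_p(Z). *)
Definition represents (B A : finType) (Gamma : digraph B) (G : digraph A)
    (T : textile Gamma G) (Z : set (fullshift B)) (X : set (fullshift A))
    (phi : fullshift A -> fullshift A) : Prop :=
  [/\ {in Z &, injective (path_map (tp T))},
      path_map (tp T) @` Z = X,
      path_map (tq T) @` Z `<=` X &
      forall z, Z z -> phi (path_map (tp T) z) = path_map (tq T) z].

(* The graph G of the textile system is taken to have the alphabet of X as
   arc-set, so that phi_p and phi_q take values in the full shift containing
   X; G itself is existentially quantified. *)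
Definition weakly_p_resolving (P : hom_property) (A : finType)
    (X : set (fullshift A)) (phi : fullshift A -> fullshift A) : Prop :=
  exists (B : finType) (Gamma : digraph B) (G : digraph A)
         (T : textile Gamma G) (Z : set (fullshift B)),
    [/\ P B A Gamma G (tp T), Z `<=` path_space Gamma, closed Z,
        shiftz 1 @` Z = Z & represents T Z X phi].

Definition weakly_pL (A : finType) (X : set (fullshift A))
    (phi : fullshift A -> fullshift A) : Prop :=
  weakly_p_resolving weakly_left_resolving X phi.

Definition weakly_pR (A : finType) (X : set (fullshift A))
    (phi : fullshift A -> fullshift A) : Prop :=
  weakly_p_resolving weakly_right_resolving X phi.

Definition textile_rows (B A : finType) (Gamma : digraph B) (G : digraph A)
    (T : textile Gamma G) : set (fullshift B) :=
  [set z | path_space Gamma z /\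
    exists w : int -> fullshift B,
      [/\ forall i, path_space Gamma (w i), w 0 = z &
          forall i, path_map (tq T) (w (i - 1)) = path_map (tp T) (w i)]].

Definition p_resolving (P : hom_property) (A : finType) (G : digraph A)
    (phi : fullshift A -> fullshift A) : Prop :=
  exists (B : finType) (Gamma : digraph B) (T : textile Gamma G),
    P B A Gamma G (tp T) /\ represents T (textile_rows T) (path_space G) phi.

Definition pL (A : finType) (G : digraph A)
    (phi : fullshift A -> fullshift A) : Prop :=
  p_resolving left_resolving G phi.

Definition pR (A : finType) (G : digraph A)
    (phi : fullshift A -> fullshift A) : Prop :=
  p_resolving right_resolving G phi.

Definition full_orbit (A : finType) (X : set (fullshift A))
    (phi : fullshift A -> fullshift A) (x : int -> fullshift A) : Prop :=
  (forall i, X (x i)) /\ (forall i : int, phi (x i) = x (i + 1)).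

Definition left_expansive_upper (R : realType) (A : finType)
    (X : set (fullshift A)) (d : fullshift A -> fullshift A -> R)
    (phi : fullshift A -> fullshift A) : Prop :=
  exists2 delta : R, 0 < delta &
    forall x y : int -> fullshift A,
      full_orbit X phi x -> full_orbit X phi y ->
      (forall i j : int, i <= 0 -> j <= 0 ->
         d (shiftz j (x i)) (shiftz j (y i)) <= delta) ->
      x = y.

Definition right_expansive_upper (R : realType) (A : finType)
    (X : set (fullshift A)) (d : fullshift A -> fullshift A -> R)
    (phi : fullshift A -> fullshift A) : Prop :=
  exists2 delta : R, 0 < delta &
    forall x y : int -> fullshift A,
      full_orbit X phi x -> full_orbit X phi y ->
      (forall i j : int, i <= 0 -> 0 <= j ->
         d (shiftz j (x i)) (shiftz j (y i)) <= delta) ->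
      x = y.

(* Main.v *)
Require Import Defs.
From HB Require Import structures.
From mathcomp Require Import all_boot all_order all_algebra.
From mathcomp Require Import all_classical all_reals all_analysis.
From mathcomp Require Import zify lra.

Set Implicit Arguments.
Unset Strict Implicit.
Unset Printing Implicit Defensive.

Import Order.TTheory GRing.Theory Num.Theory.

Local Open Scope classical_set_scope.
Local Open Scope ring_scope.

(** Fix a direction: left-to-right for the statements about PL, weakly p-L,
    p-L and right expansiveness, right-to-left for their mirror images.
    Everything reduces to one property of an endomorphism phi of X, called
    [determined e X phi k] below: in the direction [e], the coordinates >= 0 of
    a point of X determine the coordinate k of its image.  This property is
    monotone in k, composition with a power of the shift translates k, and a
    local rule is I left-redundant exactly when it holds for k = m - I.  Hence
    the degree of phi is the largest k, possibly infinite, such that phi is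
    determined at -k ([degreeP]), and the inequalities between s and the degree
    say that psi = phi sigma^s is determined at 0 (weak inequality) or at -1
    (strict inequality).  It remains to characterize these two properties.

    Determined at 0 is the same as memory zero, because by compactness a value
    that depends on the whole ray depends on finitely many coordinates of it
    ([finite_window]).

    Determined at 0 is the same as weakly p-resolving.  If (p, q) is a weakly
    resolving textile system, the inverse of phi_p on Z is a block map, so two
    points of X that agree on a ray have preimages that agree on a smaller ray,
    and weak resolution recovers their remaining arcs one at a time
    ([weakly_resolving_determined]).  Conversely, if psi x 0 is a function of
    x_0, ..., x_n, take as arcs the words of length n + 2 of X and as vertices
    those of length n + 1, let p read the first letter and let q apply psi; an
    arc is then its first letter followed by its terminal vertex
    ([block_textile], [block_weakly_resolving]).

    If X is the path space of a nondegenerate graph G, both maps of that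
    textile system are homomorphisms into G itself, p is resolving because
    every path extends to a bi-infinite one, and every path of the block graph
    is a row of the textile because psi is onto ([determined_resolving]).
    Conversely a resolving textile system is a weakly resolving one, once its
    set of rows is known to be closed: it is the set of the paths z with
    phi_q z = psi (phi_p z) ([textile_rowsE]).

    If psi is determined at -1, each application of psi enlarges by one
    coordinate the ray on which two points agree.  So if all the points of
    index <= 0 of two orbits agree on a common ray, they agree everywhere
    ([determined_expansive]). *)

(* The library of sequences has a lemma of the same name. *)
Local Notation path_map := Defs.path_map.

(** * Compactness of the full shift *)

Lemma fullshift_cvgP (A : finType) (F : set_system (fullshift A))
    (x : fullshift A) :
  Filter F -> F --> x <-> forall j, \forall y \near F, y j = x j.
Proof.
move=> FF; split=> [Fx j|Fx].
- have /(_ [set a | a = x j]) :=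
    @proj_continuous int (fun=> discrete_topology A) j x.
  move=> /(_ (discrete_set1 _)); exact: Fx.
- apply/cvg_sup => j; apply/cvg_image.
    by rewrite eqEsubset; split => y //= _; exists (fun=> y).
  move=> U /nbhs_singleton Ux; exists [set y : fullshift A | U (y j)].
    by apply: filterS (Fx j) => y /= ->.
  rewrite eqEsubset; split=> [_ [y /= Uy <-] //|a Ua].
  by exists (fun=> a).
Qed.

Lemma near_coord (A : finType) (x : fullshift A) (j : int) :
  \forall y \near x, y j = x j.
Proof. by have /fullshift_cvgP : x --> x by []; apply. Qed.

Lemma fullshift_compact (A : finType) : compact [set: fullshift A].
Proof.
have := @tychonoff int (fun=> discrete_topology A) (fun=> setT).
have -> : [set f : int -> discrete_topology A |
    forall i, [set: discrete_topology A] (f i)] = setT by apply/seteqP; split.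
apply => i; apply: finite_compact; exact: (@finite_finset A).
Qed.

Definition locally_constant (T : topologicalType) (K : set T) (C : Type)
    (g : T -> C) : Prop :=
  forall x, K x -> \forall y \near x, K y -> g y = g x.

(** Compactness of K x K: a pair (a, b) is either harmless near it, because g
    takes the same value at both points, or is separated by a coordinate j in S,
    and then so are the nearby pairs; finitely many such j suffice. *)
Lemma finite_window (T : topologicalType) (K : set T) (A : finType) (C : Type)
    (F : T -> fullshift A) (g : T -> C) (S : set int) :
  compact K -> (forall j, locally_constant K (F^~ j)) ->
  locally_constant K g ->
  (forall a b, K a -> K b -> (forall j, S j -> F a j = F b j) -> g a = g b) ->
  exists n : nat, forall a b, K a -> K b ->
    (forall j, S j -> (`|j| <= n)%N -> F a j = F b j) -> g a = g b.
Proof.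
move=> cK lF lg det.
pose P (n : nat) (ab : T * T) := K ab.1 -> K ab.2 ->
  (forall j, S j -> (`|j| <= n)%N -> F ab.1 j = F ab.2 j) -> g ab.1 = g ab.2.
have /compact_near_coveringP/(_ nat \oo P _) := compact_setX cK cK.
case=> [[a b] [/= Ka Kb]|n _ nP].
  (* The pair is harmless: g stays constant around a and around b. *)
  have [gab|gab] := pselect (g a = g b).
    have na : \forall x \near (a, b) & n \near \oo, K x.1 -> g x.1 = g a.
      exists ([set x | K x.1 -> g x.1 = g a], setT).
        split; last exact: filterT.
        exists ([set x | K x -> g x = g a], setT).
          by split; [exact: lg|exact: filterT].
        by move=> [x y] /= [].
      by move=> [x y] /= [].
    have nb : \forall x \near (a, b) & n \near \oo, K x.2 -> g x.2 = g b.
      exists ([set x | K x.2 -> g x.2 = g b], setT).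
        split; last exact: filterT.
        exists (setT, [set x | K x -> g x = g b]).
          by split; [exact: filterT|exact: lg].
        by move=> [x y] /= [].
      by move=> [x y] /= [].
    apply: filterS2 na nb => -[[x y] n] /= gx gy Kx Ky _.
    by rewrite gx // gy.
  (* The pair is separated by a coordinate, which persists around (a, b). *)
  have [j [Sj Fj]] : exists j, S j /\ F a j <> F b j.
    apply: contrapT => nex; apply: gab; apply: det => // j Sj.
    by apply: contrapT => Fj; apply: nex; exists j.
  exists ([set x | (K x.1 -> F x.1 j = F a j) /\ (K x.2 -> F x.2 j = F b j)],
          [set n | (`|j| <= n)%N]).
    split; last by exists `|j|%N.
    exists ([set x | K x -> F x j = F a j], [set x | K x -> F x j = F b j]).
      by split; exact: lF.
    by move=> [x y] /= [].
  move=> [[x y] n] /= [[Fx Fy] jn] Kx Ky /(_ j Sj jn).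
  by rewrite Fx // Fy.
exists n => a b Ka Kb; apply: (nP n (leqnn n) (a, b)) => //.
Qed.

Lemma locally_constant_coord (A : finType) (K : set (fullshift A)) (j : int) :
  locally_constant K (fun x => x j).
Proof. by move=> x _; apply: filterS (near_coord x j) => y. Qed.

Lemma endomorphism_coord (A : finType) (X : set (fullshift A))
    (phi : fullshift A -> fullshift A) (j : int) :
  {within X, continuous phi} -> locally_constant X (fun x => phi x j).
Proof.
move=> /subspace_continuousP cphi x Xx.
by have := cphi x Xx _ (near_coord (phi x) j).
Qed.

Lemma closed_compact (A : finType) (X : set (fullshift A)) :
  closed X -> compact X.
Proof. by move=> cX; apply: subclosed_compact (@fullshift_compact A) _. Qed.

(** * Directions and shifts *)

(** Left and right statements are proved together: [e] is true for the
    coordinates read from left to right and false for the mirror image. *)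
Definition along (e : bool) (j : int) : int := if e then j else - j.

Lemma alongK e : involutive (along e).
Proof. by case: e => j //=; rewrite opprK. Qed.

Lemma along0 e : along e 0 = 0.
Proof. by case: e. Qed.

Lemma alongD e i j : along e (i + j) = along e i + along e j.
Proof. by case: e => //=; rewrite opprD. Qed.

Lemma shiftzD (A : finType) (i j : int) (x : fullshift A) :
  shiftz i (shiftz j x) = shiftz (i + j) x.
Proof. by apply/funext => k; rewrite /shiftz addrA. Qed.

Lemma shiftz0 (A : finType) (x : fullshift A) : shiftz 0 x = x.
Proof. by apply/funext => k; rewrite /shiftz addr0. Qed.

(** Only the image under one step is assumed to be X, but this makes X stable
    under the inverse shift as well. *)
Lemma shift_invariant (A : finType) (X : set (fullshift A)) (k : int)
    (x : fullshift A) :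
  shiftz 1 @` X = X -> X x -> X (shiftz k x).
Proof.
move=> sX; elim: k x => [|n IH|n IH] x Xx; first by rewrite shiftz0.
- by rewrite intS -shiftzD -sX; exists (shiftz n%:Z x) => //; exact: IH.
- move: (Xx); rewrite -{1}sX => -[y Xy <-].
  by rewrite shiftzD intS opprD addrAC addNr add0r; exact: IH.
Qed.

Lemma endomorphism_shiftz (A : finType) (X : set (fullshift A))
    (phi : fullshift A -> fullshift A) (k : int) (x : fullshift A) :
  subshift X -> endomorphism X phi -> X x ->
  phi (shiftz k x) = shiftz k (phi x).
Proof.
move=> [_ sX] [_ _ com]; elim: k x => [|n IH|n IH] x Xx.
- by rewrite !shiftz0.
- by rewrite intS -!shiftzD com ?IH //; exact: shift_invariant.
- move: (Xx); rewrite -{1}sX => -[y Xy <-].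
  by rewrite com // !shiftzD intS opprD addrAC addNr add0r IH.
Qed.

Lemma endomorphism_comp_shiftz (A : finType) (X : set (fullshift A))
    (phi : fullshift A -> fullshift A) (s : int) :
  subshift X -> endomorphism X phi -> endomorphism X (phi \o shiftz s).
Proof.
move=> hX hphi; have [sX [phiX cphi _]] := (hX.2, hphi); split.
- by move=> x Xx; apply: phiX; exact: shift_invariant.
- apply/subspace_continuousP => x Xx; apply/fullshift_cvgP => j.
  have := endomorphism_coord (j + s) cphi Xx.
  apply: filterS => y + Xy => /(_ Xy) /= E.
  by rewrite /from_subspace /= !(endomorphism_shiftz s hX hphi).
- move=> x Xx /=.
  rewrite shiftzD addrC -shiftzD.
  by rewrite (endomorphism_shiftz 1 hX hphi) //; exact: shift_invariant.
Qed.

Definition determined (e : bool) (A : finType) (X : set (fullshift A))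
    (phi : fullshift A -> fullshift A) (k : int) : Prop :=
  forall a b, X a -> X b ->
    (forall j : int, 0 <= j -> a (along e j) = b (along e j)) ->
    phi a (along e k) = phi b (along e k).

(** Composing with a power of the shift moves the determined coordinate, so all
    the endomorphisms phi sigma^s are governed by the degree of phi. *)
Lemma determined_shift (e : bool) (A : finType) (X : set (fullshift A))
    (phi : fullshift A -> fullshift A) (s k : int) :
  subshift X -> endomorphism X phi ->
  determined e X (phi \o shiftz s) k <-> determined e X phi (k + along e s).
Proof.
move=> hX hphi; have E x : X x ->
    (phi \o shiftz s) x (along e k) = phi x (along e (k + along e s)).
  by move=> Xx /=; rewrite (endomorphism_shiftz _ hX hphi) // alongD alongK.
by split=> det a b Xa Xb /(det a b Xa Xb); rewrite !E.
Qed.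

Lemma determined_le (e : bool) (A : finType) (X : set (fullshift A))
    (phi : fullshift A -> fullshift A) (k l : int) :
  subshift X -> endomorphism X phi -> k <= l ->
  determined e X phi k -> determined e X phi l.
Proof.
move=> hX hphi kl det a b Xa Xb ab; pose t := along e (l - k).
have E x : X x -> phi x (along e l) = phi (shiftz t x) (along e k).
  move=> Xx; rewrite (endomorphism_shiftz _ hX hphi) // /shiftz /t -alongD.
  by congr (phi x (along e _)); lia.
have sX x : X x -> X (shiftz t x) by apply: shift_invariant; case: hX.
rewrite !E //; apply: det; [exact: sX|exact: sX|].
by move=> j j0; rewrite /shiftz /t -alongD ab //; lia.
Qed.

(** * Local rules and degrees *)

Lemma factor_through (T U V : Type) (K : set T) (h : T -> U) (g : T -> V)
    (v : V) :
  (forall a b, K a -> K b -> h a = h b -> g a = g b) ->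
  exists f, forall a, K a -> f (h a) = g a.
Proof.
move=> hg.
exists (fun u => if pselect (exists2 a, K a & h a = u) is left E
                 then g (projT1 (cid2 E)) else v).
move=> a Ka; case: pselect => [E|[]]; last by exists a.
by case: cid2 => b /= Kb hb; exact: hg.
Qed.

Lemma word_eq (A : finType) (a b : fullshift A) (i : int) (k : nat) :
  word a i k = word b i k <->
  forall l : nat, (l < k)%N -> a (i + l%:Z) = b (i + l%:Z).
Proof.
split=> [ab l lk|ab]; last first.
  by apply: eq_from_tnth => l; rewrite !tnth_mktuple; exact: ab.
by have := congr1 (fun t => tnth t (Ordinal lk)) ab; rewrite !tnth_mktuple.
Qed.

Lemma of_type_window (A : finType) (X : set (fullshift A))
    (phi : fullshift A -> fullshift A) (m n : nat)
    (f : (m + n).+1.-tuple A -> A) (j : int) (a b : fullshift A) :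
  of_type X phi f -> X a -> X b ->
  (forall i, j - m%:Z <= i <= j + n%:Z -> a i = b i) -> phi a j = phi b j.
Proof.
move=> [_ phiE] Xa Xb ab; rewrite !phiE //; congr f; apply/word_eq => l lmn.
by apply: ab; lia.
Qed.

(** The local rule sends a word to the value at 0 of the image of any point in
    which the word occurs; its values form a shift of phi x, hence a point of
    X. *)
Lemma window_of_type (A : finType) (X : set (fullshift A))
    (phi : fullshift A -> fullshift A) (m n : nat) :
  (0 < #|A|)%N -> subshift X -> endomorphism X phi ->
  (forall a b, X a -> X b ->
     (forall i, - m%:Z <= i <= n%:Z -> a i = b i) -> phi a 0 = phi b 0) ->
  exists f : (m + n).+1.-tuple A -> A, of_type X phi f.
Proof.
move=> /card_gt0P[c _] hX hphi win.
have [f fE] : exists f, forall a, X a ->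
    f (word a (- m%:Z) (m + n).+1) = phi a 0.
  apply: (factor_through c) => a b Xa Xb /word_eq ab; apply: win => // i imn.
  have := ab (absz (i + m%:Z)).
  rewrite (_ : - m%:Z + (absz (i + m%:Z))%:Z = i); last by lia.
  by apply; lia.
have phiE x : X x -> forall j, phi x j = f (word x (j - m%:Z) (m + n).+1).
  move=> Xx j; have Xjx : X (shiftz j x) by apply: shift_invariant => //; case: hX.
  have := fE _ Xjx; rewrite (endomorphism_shiftz _ hX hphi) // /shiftz add0r.
  move=> <-; congr f; apply: eq_from_tnth => l; rewrite !tnth_mktuple.
  by congr (x _); lia.
exists f; split=> // x Xx; have [sX phiX] : shiftz 1 @` X = X /\ X (phi x).
  by split; [case: hX|case: hphi => + _ _; apply].
rewrite (_ : (fun j => _) = shiftz m%:Z (phi x)); first exact: shift_invariant.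
apply/funext => j; rewrite /shiftz phiE //; congr f.
by apply: eq_from_tnth => l; rewrite !tnth_mktuple; congr (x _); lia.
Qed.

Lemma endomorphism_window (A : finType) (X : set (fullshift A))
    (phi : fullshift A -> fullshift A) (S : set int) :
  subshift X -> endomorphism X phi ->
  (forall a b, X a -> X b -> (forall j, S j -> a j = b j) ->
     phi a 0 = phi b 0) ->
  exists n : nat, forall a b, X a -> X b ->
    (forall j, S j -> (`|j| <= n)%N -> a j = b j) -> phi a 0 = phi b 0.
Proof.
move=> [cX _] [_ cphi _]; apply: (finite_window (F := id)).
- exact: closed_compact.
- exact: locally_constant_coord.
- exact: (endomorphism_coord 0 cphi).
Qed.

Lemma curtis_hedlund_lyndon (A : finType) (X : set (fullshift A))
    (phi : fullshift A -> fullshift A) :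
  (0 < #|A|)%N -> subshift X -> endomorphism X phi ->
  exists (n : nat) (f : (n + n).+1.-tuple A -> A), of_type X phi f.
Proof.
move=> A0 hX hphi.
have [|n win] := @endomorphism_window _ _ _ setT hX hphi.
  by move=> a b _ _ ab; congr (phi _ 0); apply/funext => j; exact: ab.
exists n; apply: window_of_type => // a b Xa Xb ab; apply: win => // j _ jn.
by apply: ab; lia.
Qed.

(** Dependence on a ray is dependence on finitely many of its coordinates. *)
Lemma memory_zeroP (A : finType) (X : set (fullshift A))
    (phi : fullshift A -> fullshift A) :
  (0 < #|A|)%N -> subshift X -> endomorphism X phi ->
  memory_zero X phi <-> determined true X phi 0.
Proof.
move=> A0 hX hphi; split=> [[n [f tf]] a b Xa Xb ab|det].
  by apply: (of_type_window tf) => // i /= i0; apply: ab; lia.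
have [n win] := @endomorphism_window _ _ _ [set j | 0 <= j] hX hphi det.
exists n; apply: window_of_type => // a b Xa Xb ab.
by apply: win => // j /= j0 jn; apply: ab; lia.
Qed.

Lemma anticipation_zeroP (A : finType) (X : set (fullshift A))
    (phi : fullshift A -> fullshift A) :
  (0 < #|A|)%N -> subshift X -> endomorphism X phi ->
  anticipation_zero X phi <-> determined false X phi 0.
Proof.
move=> A0 hX hphi; split=> [[m [f tf]] a b Xa Xb ab|det].
  apply: (of_type_window tf) => // i i0.
  by rewrite -[i]opprK; apply: (ab (- i)); move: i0; rewrite /=; lia.
have [|n win] := @endomorphism_window _ _ _ [set j | j <= 0] hX hphi.
  move=> a b Xa Xb ab; apply: (det a b Xa Xb) => j j0; apply: ab => /=; lia.
exists n; apply: window_of_type => // a b Xa Xb ab.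
by apply: win => // j /= j0 jn; apply: ab; lia.
Qed.

Lemma strictly_exists (red : nat -> Prop) :
  red 0%N -> exists I, strictly red I.
Proof.
move=> r0; have [rall|/existsNP[k nrk]] := pselect (forall k, red k).
  by exists +oo%E.
elim: k nrk => [//|k IH] nrk.
have [rk|/IH//] := pselect (red k).
by exists (k%:Z%:E); exists k.
Qed.

(** Here m is the memory for left redundancy and the anticipation for right
    redundancy; I - m is then the largest k with D (- k). *)
Lemma strictly_le (red : nat -> Prop) (D : int -> Prop) (m : nat) (I : \bar int)
    (k : int) :
  (forall i j, i <= j -> D i -> D j) ->
  (forall i, red i <-> D (m%:Z - i%:Z)) ->
  strictly red I -> (k%:E <= I - m%:Z%:E)%E <-> D (- k).
Proof.
move=> mD redE; case: I => [_ [i [-> ri nri]]|rall|//] /=.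
  rewrite -EFinB lee_fin; split=> [ki|Dk].
    by move/redE: ri; apply: mD; lia.
  rewrite leNgt; apply/negP => ik; apply: nri; apply/redE.
  by apply: mD Dk; lia.
rewrite addye // leey; split=> // _; have /redE := rall (absz (m%:Z + k)).
by apply: mD; lia.
Qed.

Definition degree (e : bool) (A : finType) (X : set (fullshift A))
    (phi : fullshift A -> fullshift A) : \bar int :=
  if e then PL X phi else PR X phi.

Lemma left_redundantP (A : finType) (X : set (fullshift A))
    (phi : fullshift A -> fullshift A) (m n : nat)
    (f : (m + n).+1.-tuple A -> A) (i : nat) :
  of_type X phi f ->
  left_redundant X f i <-> determined true X phi (m%:Z - i%:Z).
Proof.
move=> [_ phiE]; have E x : X x ->
    f (word x (- i%:Z) (m + n).+1) = phi x (m%:Z - i%:Z).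
  by move=> Xx; rewrite phiE // addrAC subrr add0r.
by split=> red a b Xa Xb /(red a b Xa Xb); rewrite /= !E.
Qed.

Lemma right_redundantP (A : finType) (X : set (fullshift A))
    (phi : fullshift A -> fullshift A) (m n : nat)
    (f : (m + n).+1.-tuple A -> A) (i : nat) :
  of_type X phi f ->
  right_redundant X f i <-> determined false X phi (n%:Z - i%:Z).
Proof.
move=> [_ phiE]; have E x : X x ->
    f (word x (i%:Z - (m + n)%N%:Z) (m + n).+1) = phi x (- (n%:Z - i%:Z)).
  by move=> Xx; rewrite phiE //; congr (f (word _ _ _)); lia.
split=> red a b Xa Xb ab; have := red a b Xa Xb; rewrite /= !E //; apply.
  by move=> j j0; rewrite -[j]opprK; apply: ab; lia.
by move=> j j0; apply: ab; lia.
Qed.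

(** Every type (m, n) and local rule of phi give the same value by
    [strictly_le], since the right-hand side does not mention them. *)
Lemma degreeP (e : bool) (A : finType) (X : set (fullshift A))
    (phi : fullshift A -> fullshift A) (k : int) :
  (0 < #|A|)%N -> subshift X -> endomorphism X phi ->
  (k%:E <= degree e X phi)%E <-> determined e X phi (- k).
Proof.
move=> A0 hX hphi.
have mono i j : i <= j -> determined e X phi i -> determined e X phi j.
  exact: determined_le.
have [n [f tf]] := curtis_hedlund_lyndon A0 hX hphi.
case: e mono => mono; rewrite /degree /PL /PR; case: xgetP => [p _|none].
- move=> [m' [n' [f' [I [tf' sI ->]]]]]; apply: (strictly_le k mono _ sI) => i.
  exact: left_redundantP.
- have [|I sI] := @strictly_exists (left_redundant X f).
    apply/(left_redundantP _ tf) => a b Xa Xb ab; apply: (of_type_window tf) => //.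
    by move=> i /= i_n; apply: ab; lia.
  by case: (none (I - n%:Z%:E)%E); exists n, n, f, I.
- move=> [m' [n' [f' [I [tf' sI ->]]]]]; apply: (strictly_le k mono _ sI) => i.
  exact: right_redundantP.
- have [|I sI] := @strictly_exists (right_redundant X f).
    apply/(right_redundantP _ tf) => a b Xa Xb ab; apply: (of_type_window tf) => //.
    by move=> i i_n; rewrite -[i]opprK; apply: (ab (- i)); move: i_n => /=; lia.
  by case: (none (I - n%:Z%:E)%E); exists n, n, f, I.
Qed.

(** * Expansiveness *)

(** Around each point of X the metric balls are finer than the cylinders; a
    Lebesgue number gives a radius valid on the whole of X. *)
Lemma compatible_metric_separates (R : realType) (A : finType)
    (X : set (fullshift A)) (d : fullshift A -> fullshift A -> R) :
  closed X -> compatible_metric X d ->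
  exists2 delta : R, 0 < delta &
    forall x y, X x -> X y -> d x y <= delta -> x 0 = y 0.
Proof.
move=> cX [_ _ dC dtri dnbhs].
pose P (delta : R) (x : fullshift A) :=
  X x -> forall y, X y -> d x y <= delta -> x 0 = y 0.
have near_sep : \forall delta \near (0:R)^'+, X `<=` P delta; last first.
  have [delta [delta0 deltaP]] :
      exists delta : R, 0 < delta /\ X `<=` P delta.
    have near_gt : \forall delta \near (0:R)^'+, 0 < delta.
      exact: nbhs_right_gt.
    by have [delta] := filter_ex (filterI near_gt near_sep); exists delta.
  by exists delta => // x y Xx Xy; exact: deltaP.
have /compact_near_coveringP := closed_compact cX; apply=> x Xx.
  have [e e0 xe] : exists2 e : R, 0 < e &
      forall y, X y -> d x y < e -> y 0 = x 0.
    apply/(dnbhs x Xx [set y | y 0 = x 0]).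
    by apply: filterS (near_coord x 0) => y.
  have e20 : 0 < e / 2 by rewrite divr_gt0.
  exists ([set y | X y -> d x y < e / 2], [set t : R | t < e / 2]).
    split=> /=; last exact: nbhs_right_lt.
    by apply/(dnbhs x Xx [set y | d x y < e / 2]); exists (e / 2).
  move=> [x' t] /= [dxx' te] Xx' y Xy dx'y.
  rewrite (xe y) ?(xe x') //.
    by apply: lt_le_trans (dxx' Xx') _; lra.
  have := dtri _ _ _ Xx Xx' Xy; have := dxx' Xx'; lra.
Qed.

Definition expansive_upper (e : bool) (R : realType) (A : finType)
    (X : set (fullshift A)) (d : fullshift A -> fullshift A -> R)
    (phi : fullshift A -> fullshift A) : Prop :=
  exists2 delta : R, 0 < delta &
    forall x y : int -> fullshift A,
      full_orbit X phi x -> full_orbit X phi y ->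
      (forall i j : int, i <= 0 -> 0 <= j ->
         d (shiftz (along e j) (x i)) (shiftz (along e j) (y i)) <= delta) ->
      x = y.

(** Going back k steps along the two orbits and applying phi k times shows that
    the points of index <= 0 agree on the ray from -k, for every k. *)
Lemma determined_expansive (e : bool) (R : realType) (A : finType)
    (X : set (fullshift A)) (d : fullshift A -> fullshift A -> R)
    (phi : fullshift A -> fullshift A) :
  subshift X -> compatible_metric X d -> endomorphism X phi ->
  determined e X phi (- 1) -> expansive_upper e X d phi.
Proof.
move=> hX hd hphi det; have [cX sX] := hX.
have [delta delta0 sep] := compatible_metric_separates cX hd.
exists delta => // x y [Xx phix] [Xy phiy] near_xy.
have agree k : forall i : int, i <= 0 -> forall j : int, - k%:Z <= j ->
    x i (along e j) = y i (along e j).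
  elim: k => [|k IH] i i0 j kj.
    rewrite -[along e j]add0r; 
    apply: (sep (shiftz (along e j) (x i)) (shiftz (along e j) (y i)));
      try exact: shift_invariant.
    by apply: near_xy => //; lia.
  have E (z : int -> fullshift A) : (forall i, X (z i)) ->
      (forall i : int, phi (z i) = z (i + 1)) ->
      z i (along e j) =
      phi (shiftz (along e (j + 1)) (z (i - 1))) (along e (- 1)).
    move=> Xz phiz; rewrite (endomorphism_shiftz _ hX hphi) // phiz subrK.
    by rewrite /shiftz -alongD; congr (z i (along e _)); lia.
  rewrite !E //; apply: det; try exact: shift_invariant.
  by move=> l l0; rewrite /shiftz -alongD; apply: IH; lia.
have past i : i <= 0 -> x i = y i.
  move=> i0; apply/funext => j; rewrite -(alongK e j).
  by apply: (agree `|along e j|%N) => //; lia.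
apply/funext; case=> n; last by apply: past; lia.
elim: n => [|n IH]; first exact: past.
by rewrite intS addrC -phix -phiy IH.
Qed.

(** * Path spaces and resolving homomorphisms *)

Lemma closed_equalizer (T : topologicalType) (K : set T) (I C : Type)
    (g h : I -> T -> C) :
  closed K -> (forall i, locally_constant K (g i)) ->
  (forall i, locally_constant K (h i)) ->
  closed [set x | K x /\ forall i, g i x = h i x].
Proof.
move=> cK lg lh x clx.
have Kx : K x.
  by apply: cK => U /clx[y [[Ky _] Uy]]; exists y.
split=> // i; have [y [[Ky gh] [gy hy]]] := clx _ (filterI (lg i x Kx) (lh i x Kx)).
by rewrite -(gy Ky) gh hy.
Qed.

Lemma shift_image (A : finType) (Z : set (fullshift A)) (s : int) :
  (forall k z, Z z -> Z (shiftz k z)) -> shiftz s @` Z = Z.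
Proof.
move=> sZ; apply/seteqP; split=> [_ [z Zz <-]|z Zz]; first exact: sZ.
by exists (shiftz (- s) z); [exact: sZ|rewrite shiftzD subrr shiftz0].
Qed.

(** The end of an arc that is met last when the path is read in the direction
    [e]; the other end is [tip (~~ e)]. *)
Definition tip (e : bool) (A : finType) (G : digraph A) : A -> vert G :=
  if e then ter G else ini G.

Lemma path_spaceP (e : bool) (A : finType) (G : digraph A) (x : fullshift A) :
  path_space G x <->
  forall j, tip e G (x (along e j)) = tip (~~ e) G (x (along e (j + 1))).
Proof.
case: e => //; split=> path j /=.
  by rewrite path; congr (ini G (x _)); lia.
by have := path (- (j + 1)); rewrite /= opprK => ->; congr (ter G (x _)); lia.
Qed.

Lemma path_space_shiftz (A : finType) (G : digraph A) (k : int)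
    (x : fullshift A) :
  path_space G x -> path_space G (shiftz k x).
Proof. by move=> path j; rewrite /shiftz path addrAC. Qed.

Lemma path_space_closed (A : finType) (G : digraph A) : closed (path_space G).
Proof.
have -> : path_space G =
    [set x | setT x /\ forall j : int, ter G (x j) = ini G (x (j + 1))].
  by apply/seteqP; split=> [x|x []].
apply: closed_equalizer => [|j x _|j x _]; first exact: closedT.
- by apply: filterS (near_coord x j) => y /= ->.
- by apply: filterS (near_coord x (j + 1)) => y /= ->.
Qed.

Lemma hom_tip (e : bool) (B A : finType) (Gamma : digraph B) (G : digraph A)
    (h : graph_hom Gamma G) (b : B) :
  tip e G (h b) = hom_vert h (tip e Gamma b).
Proof. by case: e; [exact: hom_ter|exact: hom_ini]. Qed.

Lemma path_map_path (B A : finType) (Gamma : digraph B) (G : digraph A)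
    (h : graph_hom Gamma G) (z : fullshift B) :
  path_space Gamma z -> path_space G (path_map h z).
Proof. by move=> path j; rewrite hom_ter path -hom_ini. Qed.

Lemma path_map_continuous (B A : finType) (Gamma : digraph B) (G : digraph A)
    (h : graph_hom Gamma G) :
  continuous (path_map h).
Proof.
move=> z.
have FF := @fmap_filter _ _ (path_map h) (nbhs z) (nbhs_filter z).
apply: (iffRL (fullshift_cvgP _ FF)) => j.
have near_h : \forall y \near z, h (y j) = h (z j).
  by apply: filterS (near_coord z j) => y ->.
exact: near_h.
Qed.

Definition weakly_resolving (e : bool) : hom_property :=
  fun B A Gamma G h => forall b b' : B,
    tip e Gamma b = tip e Gamma b' -> h b = h b' -> b = b'.

Definition resolving (e : bool) : hom_property :=
  fun B A Gamma G h => forall (u : vert Gamma) (a : A),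
    tip e G a = hom_vert h u -> exists! b : B, h b = a /\ tip e Gamma b = u.

Lemma resolving_weakly (e : bool) (B A : finType) (Gamma : digraph B)
    (G : digraph A) (h : graph_hom Gamma G) :
  resolving e h -> weakly_resolving e h.
Proof.
move=> res b b' tb hb; have [c [_ uc]] := res _ _ (hom_tip e h b).
by rewrite -(uc b) // (uc b').
Qed.

(** Far out on the ray the arcs are read off a finite window of the labels;
    the remaining ones are recovered towards 0, each from the next arc and its
    own label. *)
Lemma weakly_resolving_determined (e : bool) (A : finType)
    (X : set (fullshift A)) (phi : fullshift A -> fullshift A) :
  weakly_p_resolving (weakly_resolving e) X phi -> determined e X phi 0.
Proof.
move=> [B [Gamma [G [T [Z [res Zpath cZ sZ [injp pZ _ phiE]]]]]]] a b.
have [|j|||n win] := @finite_window _ Z _ _ (path_map (tp T)) (fun z => z 0) setT.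
- exact: closed_compact.
- by move=> z _; apply: filterS (near_coord z j) => y; rewrite /path_map => ->.
- exact: locally_constant_coord.
- move=> z z' Zz Zz' pzz'; congr (_ 0); apply: injp; rewrite ?inE //.
  by apply/funext => j; exact: pzz'.
rewrite -pZ => -[z Zz <-] [z' Zz' <-] ab; rewrite !phiE // /path_map.
(* k counts the arcs recovered below the coordinate n. *)
have eqz k : forall j : int, 0 <= j -> n%:Z - k%:Z <= j ->
    z (along e j) = z' (along e j).
  elim: k => [|k IH] j j0 kj.
    rewrite -[along e j]add0r.
    apply: (win (shiftz (along e j) z) (shiftz (along e j) z')) => [||i _ i_n].
    - exact: shift_invariant.
    - exact: shift_invariant.
    - have := ab (along e i + j); rewrite alongD alongK; apply.
      by case: (e) => /=; lia.
  apply: res; last exact: ab.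
  have /path_spaceP path := Zpath _ Zz; have /path_spaceP path' := Zpath _ Zz'.
  by rewrite path path' IH //; lia.
by rewrite (eqz n) //; lia.
Qed.

(** * The block textile system *)

Definition block (e : bool) (A : finType) (n : nat) (x : fullshift A) :
    n.-tuple A :=
  [tuple (x (along e (l : nat)%:Z) : A) | l < n].

Definition occurs (e : bool) (A : finType) (X : set (fullshift A)) (n : nat)
    (w : n.-tuple A) : bool :=
  `[< exists2 x, X x & block e n x = w >].

(** The words of length n that occur in X, written in the direction [e]. *)
Definition occurring (e : bool) (A : finType) (X : set (fullshift A))
    (n : nat) : Type :=
  {w : n.-tuple A | occurs e X w}.

HB.instance Definition _ e A X n := Finite.on (@occurring e A X n).

Lemma occurs_block (e : bool) (A : finType) (X : set (fullshift A)) (n : nat)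
    (x : fullshift A) :
  X x -> occurs e X (block e n x).
Proof. by move=> Xx; apply/asboolP; exists x. Qed.

(** The word at the coordinate 0 of a point of X.  Words are manipulated through
    such points, as [rep] provides one for every word. *)
Definition cut (e : bool) (A : finType) (X : set (fullshift A)) (n : nat)
    (x : fullshift A) (Xx : X x) : occurring e X n :=
  exist _ (block e n x) (occurs_block e n Xx).

Definition rep (e : bool) (A : finType) (X : set (fullshift A)) (n : nat)
    (w : occurring e X n) : fullshift A :=
  projT1 (cid2 (asboolW (valP w))).

Lemma rep_in (e : bool) (A : finType) (X : set (fullshift A)) (n : nat)
    (w : occurring e X n) :
  X (rep w).
Proof. by rewrite /rep; case: cid2. Qed.

Lemma cut_eq (e : bool) (A : finType) (X : set (fullshift A)) (n : nat)
    (x y : fullshift A) (Xx : X x) (Xy : X y) :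
  cut e n Xx = cut e n Xy <->
  forall l : nat, (l < n)%N -> x (along e l%:Z) = y (along e l%:Z).
Proof.
split=> [/(congr1 val)/= xy l ln|xy]; last first.
  by apply: val_inj; apply: eq_from_tnth => l; rewrite !tnth_mktuple; exact: xy.
by have := congr1 (fun t => tnth t (Ordinal ln)) xy; rewrite !tnth_mktuple.
Qed.

Lemma cut_rep (e : bool) (A : finType) (X : set (fullshift A)) (n : nat)
    (w : occurring e X n) :
  cut e n (rep_in w) = w.
Proof. by apply: val_inj; rewrite /= /rep; case: cid2. Qed.

Lemma rep_cut (e : bool) (A : finType) (X : set (fullshift A)) (n l : nat)
    (x : fullshift A) (Xx : X x) :
  (l < n)%N -> rep (cut e n Xx) (along e l%:Z) = x (along e l%:Z).
Proof. have /cut_eq := cut_rep (cut e n Xx); apply. Qed.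

Lemma rep_cut0 (e : bool) (A : finType) (X : set (fullshift A)) (n : nat)
    (x : fullshift A) (Xx : X x) :
  rep (cut e n.+1 Xx) 0 = x 0.
Proof. by have := rep_cut e Xx (ltn0Sn n); rewrite along0. Qed.

Definition block_front (e : bool) (A : finType) (X : set (fullshift A))
    (n : nat) (w : occurring e X n.+2) : occurring e X n.+1 :=
  cut e n.+1 (rep_in w).

Definition block_back (e : bool) (A : finType) (X : set (fullshift A))
    (n : nat) (sX : shiftz 1 @` X = X) (w : occurring e X n.+2) :
    occurring e X n.+1 :=
  cut e n.+1 (shift_invariant (along e 1) sX (rep_in w)).

(** The higher block graph with its arcs oriented from left to right: when words
    are written backwards, the initial and terminal vertices are exchanged. *)
Definition block_graph (e : bool) (A : finType) (X : set (fullshift A))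
    (n : nat) (sX : shiftz 1 @` X = X) : digraph (occurring e X n.+2) :=
  Digraph (if e then @block_front e A X n else block_back sX)
          (if e then block_back sX else @block_front e A X n).

Lemma tip_block (e : bool) (A : finType) (X : set (fullshift A)) (n : nat)
    (sX : shiftz 1 @` X = X) (w : occurring e X n.+2) :
  tip e (block_graph e n sX) w = block_back sX w.
Proof. by rewrite /tip /=; case: (e) in X sX w *. Qed.

Lemma tail_block (e : bool) (A : finType) (X : set (fullshift A)) (n : nat)
    (sX : shiftz 1 @` X = X) (w : occurring e X n.+2) :
  tip (~~ e) (block_graph e n sX) w = block_front w.
Proof. by rewrite /tip /=; case: (e) in X sX w *. Qed.

(** Consecutive arcs of a path overlap, so the letters of one arc are the first
    letters of the arcs that follow it: the path spells a bi-infinite word. *)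
Lemma block_path (e : bool) (A : finType) (X : set (fullshift A)) (n : nat)
    (sX : shiftz 1 @` X = X) (z : fullshift (occurring e X n.+2)) :
  path_space (block_graph e n sX) z ->
  forall (l : nat) (j : int), (l < n.+2)%N ->
    rep (z (along e j)) (along e l%:Z) = rep (z (along e (j + l%:Z))) 0.
Proof.
move=> /(path_spaceP e) path; elim=> [|l IH] j ln; first by rewrite addr0 along0.
have := path j; rewrite tip_block tail_block => /cut_eq/(_ l ln).
rewrite /shiftz -alongD addrC -intS => ->.
by rewrite IH ?(ltnW ln) //; congr (rep (z (along e _)) _); lia.
Qed.

Lemma block_path_inj (e : bool) (A : finType) (X : set (fullshift A)) (n : nat)
    (sX : shiftz 1 @` X = X) (z z' : fullshift (occurring e X n.+2)) :
  path_space (block_graph e n sX) z -> path_space (block_graph e n sX) z' ->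
  (forall j, rep (z j) 0 = rep (z' j) 0) -> z = z'.
Proof.
move=> /block_path path /block_path path' zz'; apply/funext => j.
rewrite -[LHS]cut_rep -[RHS]cut_rep; apply/cut_eq => l ln.
by rewrite -(alongK e j) path // path' // zz'.
Qed.

Definition block_code (e : bool) (A : finType) (X : set (fullshift A)) (n : nat)
    (sX : shiftz 1 @` X = X) (x : fullshift A) (Xx : X x) :
    fullshift (occurring e X n) :=
  fun j => cut e n (shift_invariant j sX Xx).

Lemma block_code_path (e : bool) (A : finType) (X : set (fullshift A)) (n : nat)
    (sX : shiftz 1 @` X = X) (x : fullshift A) (Xx : X x) :
  path_space (block_graph e n sX) (block_code e n.+2 sX Xx).
Proof.
apply/(path_spaceP e) => j; rewrite tip_block tail_block; apply/cut_eq => l ln.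
rewrite [RHS]rep_cut ?ltnS ?(ltnW ln) // {1}/shiftz -alongD addrC -intS.
by rewrite rep_cut // /shiftz -!alongD; congr (x (along e _)); lia.
Qed.

Lemma graph_hom_of_tips (e : bool) (B A : finType) (Gamma : digraph B)
    (G : digraph A) (ha : B -> A) (hv : vert Gamma -> vert G) :
  (forall b, tip e G (ha b) = hv (tip e Gamma b)) ->
  (forall b, tip (~~ e) G (ha b) = hv (tip (~~ e) Gamma b)) ->
  exists h : graph_hom Gamma G, hom_arc h = ha /\ hom_vert h = hv.
Proof.
move=> front back; have iniE b : ini G (ha b) = hv (ini Gamma b).
  by case: e front back => front back; [exact: back|exact: front].
have terE b : ter G (ha b) = hv (ter Gamma b).
  by case: e front back => front back; [exact: front|exact: back].
by exists (GraphHom iniE terE).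
Qed.

(** The vertex maps of p and q send a word u_0, ..., u_n to the near end of u_0
    and of its image letter.  Arcs have n + 2 letters, although n + 1 of them
    suffice to compute phi, so that a vertex already determines the image
    letter; this makes q compatible with both ends. *)
Lemma block_textile (e : bool) (A : finType) (X : set (fullshift A))
    (phi : fullshift A -> fullshift A) (G : digraph A) :
  subshift X -> endomorphism X phi -> X `<=` path_space G ->
  determined e X phi 0 ->
  exists (n : nat) (sX : shiftz 1 @` X = X)
         (T : textile (block_graph e n sX) G),
    [/\ forall w, tp T w = rep w 0,
        forall u, hom_vert (tp T) u = tip (~~ e) G (rep u 0) &
        forall x (Xx : X x), tq T (cut e n.+2 Xx) = phi x 0].
Proof.
move=> hX hphi XG det; have sX := hX.2; have phiX : forall x, X x -> X (phi x).
  by case: hphi.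
have [|n win] := @endomorphism_window _ _ _ [set j | 0 <= along e j] hX hphi.
  move=> a b Xa Xb ab; have := det a b Xa Xb.
  by rewrite along0; apply=> j j0; apply: ab; rewrite /= alongK.
exists n, sX.
have phi_rep k x (Xx : X x) : (n < k)%N -> phi (rep (cut e k Xx)) 0 = phi x 0.
  move=> nk; apply: win => //; first exact: rep_in.
  move=> j /= j0 jn; have {1 2}-> : j = along e (absz j)%:Z.
    by rewrite -[LHS](alongK e); congr along; case: (e) j0 => /=; lia.
  by apply: rep_cut; lia.
have [] := @graph_hom_of_tips e _ _ (block_graph e n sX) G (fun w => rep w 0)
    (fun u => tip (~~ e) G (rep u 0)).
- move=> w; rewrite tip_block rep_cut0 /shiftz add0r.
  have /(path_spaceP e)/(_ 0) := XG _ (rep_in w).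
  by rewrite add0r along0.
- by move=> w; rewrite tail_block rep_cut0.
move=> p [pE pvE].
have [] := @graph_hom_of_tips e _ _ (block_graph e n sX) G
    (fun w => phi (rep w) 0) (fun u => tip (~~ e) G (phi (rep u) 0)).
- move=> w; rewrite tip_block phi_rep //.
  rewrite (endomorphism_shiftz _ hX hphi); last exact: rep_in.
  have /(path_spaceP e)/(_ 0) := XG _ (phiX _ (rep_in w)).
  by rewrite /shiftz !add0r along0.
- by move=> w; rewrite tail_block phi_rep.
move=> q [qE qvE]; exists (Textile p q); split=> [w|u|x Xx] /=.
- by rewrite pE.
- by rewrite pvE.
- by rewrite qE phi_rep.
Qed.

(** The arcs are local words, so a path of the block graph need not spell a
    point of X; this condition is imposed separately. *)
Definition block_rows (B A : finType) (Gamma : digraph B) (G : digraph A)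
    (T : textile Gamma G) (X : set (fullshift A)) : set (fullshift B) :=
  [set z | path_space Gamma z /\ X (path_map (tp T) z)].

Lemma block_represents (e : bool) (A : finType) (X : set (fullshift A))
    (phi : fullshift A -> fullshift A) (G : digraph A) (n : nat)
    (sX : shiftz 1 @` X = X) (T : textile (block_graph e n sX) G) :
  subshift X -> endomorphism X phi ->
  (forall w, tp T w = rep w 0) ->
  (forall x (Xx : X x), tq T (cut e n.+2 Xx) = phi x 0) ->
  represents T (block_rows T X) X phi.
Proof.
move=> hX hphi pE qE.
have inj z z' : path_space (block_graph e n sX) z ->
    path_space (block_graph e n sX) z' ->
    path_map (tp T) z = path_map (tp T) z' -> z = z'.
  move=> zp zp' pzz'; apply: (block_path_inj zp zp') => j.
  by rewrite -!pE; exact: (congr1 (fun x : fullshift A => x j) pzz').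
have code_p x (Xx : X x) : path_map (tp T) (block_code e n.+2 sX Xx) = x.
  by apply/funext => j; rewrite /path_map pE rep_cut0 /shiftz add0r.
have code_q x (Xx : X x) : path_map (tq T) (block_code e n.+2 sX Xx) = phi x.
  apply/funext => j; rewrite /path_map qE (endomorphism_shiftz _ hX hphi) //.
  by rewrite /shiftz add0r.
have rowE z : block_rows T X z ->
    exists (x : fullshift A) (Xx : X x), z = block_code e n.+2 sX Xx.
  move=> [zp Xz]; exists _, Xz; apply: inj => //.
  exact: block_code_path.
split.
- by move=> z z' /set_mem[zp _] /set_mem[zp' _]; exact: inj.
- apply/seteqP; split=> [_ [z [_ Xz] <-] //|x Xx].
  exists (block_code e n.+2 sX Xx); last exact: code_p.
  by split; [exact: block_code_path|rewrite code_p].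
- move=> _ [_ /rowE[x [Xx ->]] <-]; rewrite code_q.
  by case: hphi => + _ _; apply.
- by move=> _ /rowE[x [Xx ->]]; rewrite code_p code_q.
Qed.

(** A word is its first letter followed by its far vertex. *)
Lemma block_weakly_resolving (e : bool) (A : finType) (X : set (fullshift A))
    (G : digraph A) (n : nat) (sX : shiftz 1 @` X = X)
    (T : textile (block_graph e n sX) G) :
  (forall w, tp T w = rep w 0) -> weakly_resolving e (tp T).
Proof.
move=> pE w w'; rewrite !tip_block !pE => /cut_eq ww' ww'0.
rewrite -[LHS]cut_rep -[RHS]cut_rep; apply/cut_eq => -[_|l ln].
  by rewrite along0.
by have := ww' l ln; rewrite /shiftz -alongD addrC -intS.
Qed.

(** With the one-vertex graph every sequence is a path, so the block textile
    system exists over an arbitrary subshift. *)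
Lemma determined_weakly_resolving (e : bool) (A : finType)
    (X : set (fullshift A)) (phi : fullshift A -> fullshift A) :
  subshift X -> endomorphism X phi -> determined e X phi 0 ->
  weakly_p_resolving (weakly_resolving e) X phi.
Proof.
move=> hX hphi det.
pose G : digraph A := @Digraph A unit (fun=> tt) (fun=> tt).
have [|n [sX [T [pE _ qE]]]] := @block_textile e A X phi G hX hphi _ det.
  by [].
exists _, (block_graph e n sX), G, T, (block_rows T X); split.
- exact: block_weakly_resolving.
- by move=> z [].
- apply: closedI; first exact: path_space_closed.
  by apply: closed_comp hX.1 => z _; exact: path_map_continuous.
- apply: shift_image => k z [zp Xz]; split; first exact: path_space_shiftz.
  exact: (shift_invariant k sX Xz).
- exact: block_represents.
Qed.

(** * Topological Markov shifts *)

(** Nondegeneracy provides an infinite continuation on the free side of [a]. *)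
Lemma extend_path (e : bool) (A : finType) (G : digraph A) (x : fullshift A)
    (a : A) :
  nondegenerate_graph G -> path_space G x -> tip e G a = tip (~~ e) G (x 0) ->
  exists y, [/\ path_space G y, y 0 = a &
    forall l : nat, y (along e l.+1%:Z) = x (along e l%:Z)].
Proof.
move=> [ini_onto ter_onto] /(path_spaceP e) xp ax.
have /choice[pre preE] (v : vert G) : exists b, tip e G b = v.
  by case: (e).
pose back k := iter k (fun b => pre (tip (~~ e) G b)) a.
pose y0 (j : int) : A :=
  match j with
  | Posz 0 => a
  | Posz l.+1 => x (along e l%:Z)
  | Negz k => back k.+1
  end.
exists (fun j => y0 (along e j)); split.
- apply/(path_spaceP e) => j; rewrite !alongK.
  case: j => [[|l]|[|k]].
  + by rewrite add0r /= ax; case: (e).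
  + by rewrite addrC -intS /= xp addrC -intS.
  + by rewrite NegzE addNr /= preE.
  + by rewrite (_ : Negz k.+1 + 1 = Negz k) /= ?preE //; lia.
- by case: (e).
- by move=> l; rewrite alongK.
Qed.

(** Backwards, the orbit follows a choice of preimages. *)
Lemma orbit_through (A : finType) (X : set (fullshift A))
    (phi : fullshift A -> fullshift A) (x : fullshift A) :
  onto X phi -> X x -> exists y, full_orbit X phi y /\ y 0 = x.
Proof.
move=> ophi Xx; have phiX y : X y -> X (phi y).
  by move=> Xy; rewrite -ophi; exists y.
have /choice[g gP] y : exists z, X y -> X z /\ phi z = y.
  have [Xy|] := pselect (X y); last by exists y.
  by move: (Xy); rewrite -{1}ophi => -[z Xz zy]; exists z.
have Xg k : X (iter k g x) by elim: k => //= k /gP[].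
exists (fun i => match i with
                 | Posz k => iter k phi x
                 | Negz k => iter k.+1 g x
                 end); split=> //; split=> [[k|k]|[k|[|k]]].
- by elim: k => //= k; exact: phiX.
- exact: Xg.
- by rewrite addrC -intS.
- by rewrite NegzE addNr; exact: (gP _ Xx).2.
- rewrite (_ : Negz k.+1 + 1 = Negz k); last by lia.
  exact: (gP _ (Xg k.+1)).2.
Qed.

(** The arc required by resolution is a word of X because a letter compatible
    with a vertex can be put in front of a whole point of X. *)
Lemma determined_resolving (e : bool) (A : finType) (G : digraph A)
    (phi : fullshift A -> fullshift A) :
  nondegenerate_graph G -> subshift (path_space G) ->
  endomorphism (path_space G) phi -> onto (path_space G) phi ->
  determined e (path_space G) phi 0 -> p_resolving (resolving e) G phi.
Proof.
move=> ndG hX hphi ophi det.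
have [|n [sX [T [pE pvE qE]]]] := @block_textile e A _ phi G hX hphi _ det.
  by [].
have wres := block_weakly_resolving pE.
have rep_T := block_represents hX hphi pE qE.
exists _, (block_graph e n sX), T; split.
- move=> u a; rewrite pvE => au.
  have [y [Xy y0 yS]] := extend_path ndG (rep_in u) au.
  have wa : tp T (cut e n.+2 Xy) = a. by rewrite pE rep_cut0.
  have wu : tip e (block_graph e n sX) (cut e n.+2 Xy) = u.
    rewrite tip_block -[RHS]cut_rep; apply/cut_eq => l ln.
    by rewrite /shiftz -alongD addrC -intS rep_cut.
  exists (cut e n.+2 Xy); split=> // w [wa' wu'].
  by apply: wres; rewrite ?wu ?wa.
(* Lifting the points of a full orbit of phi to the block graph gives the rows
   of a textile through any given path. *)
- suff -> : textile_rows T = block_rows T (path_space G) by [].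
  have [inj pZ _ phiE] := rep_T.
  apply/seteqP; split=> z [zp]; first by split=> //; exact: path_map_path.
  move=> Xz; split=> //.
  have [y [[Xy phiy] yz]] := orbit_through ophi Xz.
  have /choice[w wE] i : exists w, block_rows T (path_space G) w /\
      path_map (tp T) w = y i.
    by move: (Xy i); rewrite -{1}pZ => -[w Zw wy]; exists w.
  exists w; split=> [i||i].
  + by have [[]] := wE i.
  + have [Zw pw] := wE 0; apply: inj; [exact/mem_set|exact/mem_set|].
    by rewrite pw yz.
  + have [Zw pw] := wE (i - 1); have [_ ->] := wE i.
    by rewrite -phiE // pw phiy subrK.
Qed.

(** If z satisfies the equation on the right, let z' be the row with the same
    image under phi_p; then phi_q z = phi_q z' too, so z can replace z' in the
    textile that contains it. *)
Lemma textile_rowsE (B A : finType) (Gamma : digraph B) (G : digraph A)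
    (T : textile Gamma G) (phi : fullshift A -> fullshift A) :
  represents T (textile_rows T) (path_space G) phi ->
  textile_rows T = [set z | path_space Gamma z /\
    forall j : int, path_map (tq T) z j = phi (path_map (tp T) z) j].
Proof.
move=> [_ pZ _ phiE]; apply/seteqP; split=> z.
  by move=> Zz; split=> [|j]; [case: Zz|rewrite phiE].
move=> [zp /= /funext qz]; split=> //.
have := path_map_path (tp T) zp; rewrite -pZ => -[z' Zz' pz'].
have [_ [w [wp w0 wE]]] := Zz'.
have qz' : path_map (tq T) z = path_map (tq T) (w 0).
  by rewrite qz -pz' w0 phiE.
exists (fun i => if i == 0 then z else w i); split=> [i||i]; rewrite ?eqxx //.
  by case: ifP.
case: (eqVneq i 0) => [->|i0].
  by rewrite -pz' -w0; exact: (wE 0).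
case: eqVneq => [i1|_]; last exact: wE.
by rewrite qz' -i1 wE.
Qed.

Lemma resolving_determined (e : bool) (A : finType) (G : digraph A)
    (phi : fullshift A -> fullshift A) :
  subshift (path_space G) -> endomorphism (path_space G) phi ->
  p_resolving (resolving e) G phi -> determined e (path_space G) phi 0.
Proof.
move=> hX hphi [B [Gamma [T [res rep_T]]]].
apply: weakly_resolving_determined.
exists B, Gamma, G, T, (textile_rows T); split=> //.
- exact: resolving_weakly.
- by move=> z [].
- rewrite (textile_rowsE rep_T); apply: closed_equalizer => [|j z _|j z zp].
  + exact: path_space_closed.
  + by apply: filterS (near_coord z j) => y; rewrite /path_map => ->.
  + have [_ cphi _] := hphi.
    have near_pz := endomorphism_coord j cphi (path_map_path (tp T) zp).
    have near_z := @path_map_continuous _ _ _ _ (tp T) z _ near_pz.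
    apply: (@filterS _ (nbhs z) (nbhs_filter z) _ _ _ near_z) => y E yp.
    exact: E (path_map_path _ yp).
- apply: shift_image => k z; rewrite (textile_rowsE rep_T) => -[zp qz].
  split=> [|j]; first exact: path_space_shiftz.
  have pz : path_map (tp T) (shiftz k z) = shiftz k (path_map (tp T) z) by [].
  rewrite pz (endomorphism_shiftz k hX hphi); last exact: path_map_path.
  exact: qz (j + k).
Qed.

(** * The two halves of the proposition *)

Lemma directional_half (e : bool) (R : realType) (A : finType)
    (X : set (fullshift A)) (d : fullshift A -> fullshift A -> R)
    (phi : fullshift A -> fullshift A) (s : int) :
  (0 < #|A|)%N -> subshift X -> compatible_metric X d -> endomorphism X phi ->
  let psi := phi \o shiftz s in
  let slack := (degree e X phi + (along e s)%:E)%E in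
  [/\ determined e X psi 0 <-> (0 <= slack)%E,
      weakly_p_resolving (weakly_resolving e) X psi <-> (0 <= slack)%E,
      (0 < slack)%E -> expansive_upper e X d psi &
      forall G : digraph A, nondegenerate_graph G -> X = path_space G ->
        onto X phi -> (p_resolving (resolving e) G psi <-> (0 <= slack)%E)].
Proof.
move=> A0 hX hd hphi psi slack.
have hpsi : endomorphism X psi by exact: endomorphism_comp_shiftz.
have detP k : determined e X psi (- k) <-> (k%:E <= slack)%E.
  rewrite determined_shift // (_ : - k + _ = - (k - along e s)); last by lia.
  rewrite -degreeP // /slack; case: (degree e X phi) => [i| |].
  - by rewrite -EFinD !lee_fin lerBlDr.
  - by rewrite addye // !leey.
  - by rewrite addNye.
have det0 : determined e X psi 0 <-> (0 <= slack)%E.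
  by rewrite -(detP 0) oppr0.
split=> // [|slack0|G ndG XG ophi].
- rewrite -det0; split; first exact: weakly_resolving_determined.
  exact: determined_weakly_resolving.
- apply: determined_expansive => //; apply/detP.
  by move: slack0; case: (slack).
- rewrite -det0; rewrite XG in hX hphi hpsi ophi *; split.
    exact: resolving_determined.
  apply: determined_resolving => //; rewrite /onto /psi.
  rewrite -image_comp shift_image // => k x; exact: path_space_shiftz.
Qed.

Theorem proposition6p12 (R : realType) (A : finType) (X : set (fullshift A))
    (d : fullshift A -> fullshift A -> R) (phi : fullshift A -> fullshift A)
    (s : int) :
  (1 < #|A|)%N -> subshift X -> compatible_metric X d -> endomorphism X phi ->
  [/\
    (memory_zero X (phi \o shiftz s) <-> (- PL X phi <= s%:E)%E) /\
    (anticipation_zero X (phi \o shiftz s) <-> (s%:E <= PR X phi)%E),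

    onto X phi ->
    [/\ weakly_pL X (phi \o shiftz s) <-> (- PL X phi <= s%:E)%E,
        (- PL X phi < s%:E)%E -> right_expansive_upper X d (phi \o shiftz s),
        weakly_pR X (phi \o shiftz s) <-> (s%:E <= PR X phi)%E &
        (s%:E < PR X phi)%E -> left_expansive_upper X d (phi \o shiftz s)] &

    forall G : digraph A, nondegenerate_graph G -> X = path_space G -> onto X phi ->
    [/\ pL G (phi \o shiftz s) <-> (- PL X phi <= s%:E)%E,
        (- PL X phi < s%:E)%E -> right_expansive_upper X d (phi \o shiftz s),
        pR G (phi \o shiftz s) <-> (s%:E <= PR X phi)%E &
        (s%:E < PR X phi)%E -> left_expansive_upper X d (phi \o shiftz s)]].
Proof.
move=> A1 hX hd hphi; have A0 := ltnW A1.
have hpsi := endomorphism_comp_shiftz s hX hphi.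
have [detL weakL expL resL] := directional_half true s A0 hX hd hphi.
have [detR weakR expR resR] := directional_half false s A0 hX hd hphi.
have slackL :
    (0 <= degree true X phi + s%:E)%E = (- PL X phi <= s%:E)%E /\
    (0 < degree true X phi + s%:E)%E = (- PL X phi < s%:E)%E.
  rewrite /degree; case: (PL X phi) => [i| |] //=;
    last by rewrite addye // leNye ltNye le0y lt0y.
  by rewrite -EFinD !lee_fin !lte_fin; split; lia.
have slackR :
    (0 <= degree false X phi + (- s)%:E)%E = (s%:E <= PR X phi)%E /\
    (0 < degree false X phi + (- s)%:E)%E = (s%:E < PR X phi)%E.
  rewrite /degree; case: (PR X phi) => [i| |] //=;
    last by rewrite addye // !leey !ltry.
  by rewrite -EFinD !lee_fin !lte_fin; split; lia.
rewrite /= in detL weakL expL resL detR weakR expR resR.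
rewrite slackL.1 in detL weakL resL; rewrite slackL.2 in expL.
rewrite slackR.1 in detR weakR resR; rewrite slackR.2 in expR.
have expR' : (s%:E < PR X phi)%E -> left_expansive_upper X d (phi \o shiftz s).
  move=> /expR[delta delta0 sep]; exists delta => // x y ox oy near_xy.
  by apply: sep => // i j i0 j0; apply: near_xy => //=; lia.
split=> [|_|G ndG XG ophi].
- by split; [rewrite memory_zeroP|rewrite anticipation_zeroP].
- by split; [exact: weakL|exact: expL|exact: weakR|exact: expR'].
- by split; [exact: resL|exact: expL|exact: resR|exact: expR'].
Qed.
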